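(* Let $X$ be a Hausdorff topological space, let $T:X\to X$ be a continuous map, let $(x_n)_{n\in\mathbb{N}}$ be a sequence in $X$, and let $\mathcal{E}$ be an eventual family of subsets of $\mathbb{N}$. Suppose that the sequence $(x_n)_{n\in\mathbb{N}}$ follows $T$ with respect to $\mathcal{E}$. If $y\in X$ is an accumulation point of the sequence $(x_n)_{n\in\mathbb{N}}$ with respect to $\mathcal{E}$, then $y$ is a fixed point of $T$, i.e. $T(y)=y$.
   Context: $\mathbb{N}$ denotes the positive integers. A family $\mathcal{E}$ of subsets of a set $Z$ is called an eventual family if $S\in\mathcal{E}$ and $S\subseteq S'\subseteq Z$ imply $S'\in\mathcal{E}$ (the family may be empty, and it need not be closed under intersections). The sequence $(x_n)_{n\in\mathbb{N}}$ follows $T$ with respect to $\mathcal{E}$ if for every $S\in\mathcal{E}$ there are integers $p,q\in S$ such that $x_p=T(x_q)$. A point $y\in X$ is an accumulation point of $(x_n)_{n\in\mathbb{N}}$ with respect to $\mathcal{E}$ if for every open neighborhood $U$ of $y$ the set $\{n\in\mathbb{N}\mid x_n\in U\}$ belongs to $\mathcal{E}$. *)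

(* Defs.v *)
From mathcomp Require Import all_boot.
From mathcomp Require Import boolp classical_sets topology.
Set Implicit Arguments.
Unset Strict Implicit.
Unset Printing Implicit Defensive.
Local Open Scope classical_set_scope.

(* The natural numbers are taken to start at 1. *)
Definition posnat : Type := {n : nat | (0 < n)%N}.

(* Only upward closure is required: E may be empty, may contain the empty set,
   and need not be closed under intersections, so it is not a filter. *)
Definition eventual_family (Z : Type) (E : set (set Z)) : Prop :=
  forall S S' : set Z, E S -> S `<=` S' -> E S'.

(* p and q are not required to be distinct. *)
Definition follows (X : Type) (T : X -> X) (x : posnat -> X)
    (E : set (set posnat)) : Prop :=
  forall S : set posnat, E S -> exists p q : posnat,
    [/\ S p, S q & x p = T (x q)].

Definition accumulation_point (X : topologicalType) (x : posnat -> X)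
    (E : set (set posnat)) (y : X) : Prop :=
  forall U : set X, open_nbhs y U -> E [set n | U (x n)].

(* Main.v *)
(* If A and B are neighborhoods of T y and y, then U := int (B `&` T @^-1` A)
   is an open neighborhood of y; following T along the indices n with x_n in U
   gives x_p = T x_q in both A and B, so T y and y cannot be separated. *)

Require Import Defs.
From mathcomp Require Import all_boot.
From mathcomp Require Import boolp classical_sets topology.

Theorem theorem11 (X : topologicalType) (hX : hausdorff_space X)
    (T : X -> X) (hT : continuous T) (x : posnat -> X)
    (E : set (set posnat)) (hE : eventual_family E)
    (hfollows : follows T x E) (y : X) (hy : accumulation_point x E y) :
  T y = y.
Proof.
(* [hausdorff_space] is phrased by clustering: [T y = y] follows once every neighborhood [A] of
   [T y] meets every neighborhood [B] of [y]. *)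
apply: hX => A B TyA yB.
have yU : nbhs y (setI B (preimage T A)).
  by apply: filterI => //; exact: hT.
have oU : open_nbhs y (interior (setI B (preimage T A))).
  (* Lying in the interior of a set unfolds to having that set as a neighborhood, so [yU] serves as
     is. *)
  by split; [exact: open_interior | exact: yU].
have [p [q [/= Up Uq xpq]]] := hfollows _ (hy _ oU).
exists (x p); split.
(* The index [q] accounts for [A], through the preimage; [p] accounts for [B]. *)
- by rewrite xpq; have [] := interior_subset Uq.
- by have [] := interior_subset Up.
Qed.
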